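(* The three matrices $(\mathrm{JS}(n,k;z-1))_{n,k\geq0}$, $(\mathrm{js}(n,n-k;z-1))_{n,k\geq0}$ and $(\mathrm{js}(n,k;z-1))_{n,k\geq0}$ are $z$-totally positive.
   Context: The Jacobi-Stirling numbers of the first kind $\mathrm{js}(n,k;z)$ and of the second kind $\mathrm{JS}(n,k;z)$ ($n\geq k\geq 0$) are defined by $\mathrm{js}(n,k;z)=\mathrm{js}(n-1,k-1;z)+(n-1)(n-1+z)\mathrm{js}(n-1,k;z)$ and $\mathrm{JS}(n,k;z)=\mathrm{JS}(n-1,k-1;z)+k(k+z)\mathrm{JS}(n-1,k;z)$, with $\mathrm{JS}(0,0;z)=\mathrm{js}(0,0;z)=1$ and $\mathrm{JS}(j,0;z)=\mathrm{JS}(0,j;z)=\mathrm{js}(j,0;z)=\mathrm{js}(0,j;z)=0$ for $j\geq1$ (and entries with $k>n$ or $k<0$ are $0$). A matrix with entries in $\mathbb R_+[z]$ is $z$-totally positive if every minor of it is a polynomial in $z$ with nonnegative coefficients. *)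

(* Defs.v *)
From HB Require Import structures.
From mathcomp Require Import all_boot all_order all_algebra.

Set Implicit Arguments.
Unset Strict Implicit.
Unset Printing Implicit Defensive.

Import Order.TTheory GRing.Theory Num.Theory.
Local Open Scope ring_scope.

Section JacobiStirling.
Variable A : comPzRingType.

(* The recurrence at row n = m.+1 has weight (n - 1)(n - 1 + z). *)
Fixpoint js (n k : nat) (z : A) : A :=
  match n, k with
  | 0, 0 => 1
  | 0, _.+1 => 0
  | _.+1, 0 => 0
  | m.+1, l.+1 => js m l z + m%:R * (m%:R + z) * js m l.+1 z
  end.

Fixpoint JS (n k : nat) (z : A) : A :=
  match n, k with
  | 0, 0 => 1
  | 0, _.+1 => 0
  | _.+1, 0 => 0
  | m.+1, l.+1 => JS m l z + l.+1%:R * (l.+1%:R + z) * JS m l.+1 z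
  end.

(* js(n, n - k; z), where n - k is an integer subtraction: the entries with
   k > n are zero.  Truncated subtraction alone would give the value 1 for
   n = 0 < k. *)
Definition js_rev (n k : nat) (z : A) : A :=
  if (k <= n)%N then js n (n - k)%N z else 0.

End JacobiStirling.

Section TotalPositivity.
Variable R : realFieldType.

Definition minor (M : nat -> nat -> {poly R}) (m : nat) (r c : 'I_m -> nat) :
    {poly R} :=
  \det (\matrix_(i < m, j < m) M (r i) (c j)).

(* The minors of order 1 are the entries, so this includes the requirement
   that the entries themselves have nonnegative coefficients. *)
Definition z_totally_positive (M : nat -> nat -> {poly R}) : Prop :=
  forall (m : nat) (r c : 'I_m -> nat),
    {homo r : i j / (i < j)%N} -> {homo c : i j / (i < j)%N} ->
    minor M r c \is a polyOver Num.nneg.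

End TotalPositivity.

(* Main.v *)
Require Import Defs.
From HB Require Import structures.
From mathcomp Require Import all_boot all_order all_algebra.
From mathcomp Require Import zify ring.

Set Implicit Arguments.
Unset Strict Implicit.
Unset Printing Implicit Defensive.

Import Order.TTheory GRing.Theory Num.Theory.
Local Open Scope ring_scope.

(** Each of the three triangles belongs to a family [B s] with first row
    [(1, 0, 0, ...)] in which row [n + 1] of [B s] is row [n] of [B (s + 1)]
    multiplied on the right by a bidiagonal matrix that does not depend on [n]
    and has nonnegative entries.  For JS the family is constant; for js it
    comes from taking off the first factor, instead of the last one, in
    [\prod_(i < n) (T + w i)], and likewise in [\prod_(i < n) (1 + w i T)] for
    the reversed triangle.  In a minor avoiding row [0], expanding the columns
    multilinearly gives a nonnegative combination of minors with all row
    indices lowered by one, whose column indices are weakly increasing; those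
    with a repeated column vanish.  A minor using row [0] reduces to a smaller
    one. *)

(** Multilinearity in the columns: [f] picks one summand in each column. In the Leibniz formula of
    the transpose this is distributing a product over sums. *)
Lemma det_col_bigsum (A : comPzRingType) (T : finType) m
    (F : 'I_m -> 'I_m -> T -> A) :
  \det (\matrix_(i, j) \sum_k F i j k) =
  \sum_(f : {ffun 'I_m -> T}) \det (\matrix_(i, j) F i j (f j)).
Proof.
rewrite -det_tr /determinant.
under eq_bigr => s _.
  under eq_bigr => i _ do rewrite !mxE.
  rewrite bigA_distr_bigA mulr_sumr; over.
rewrite exchange_big; apply: eq_bigr => f _.
rewrite -[RHS]/(\det _) -det_tr.
apply: eq_bigr => s _; congr (_ * _).
by apply: eq_bigr => i _; rewrite !mxE.
Qed.

Lemma det_scale_cols (A : comPzRingType) m (x : 'I_m -> A)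
    (M : 'I_m -> 'I_m -> A) :
  \det (\matrix_(i, j) (x j * M i j)) =
  (\prod_j x j) * \det (\matrix_(i, j) M i j).
Proof.
rewrite -det_tr -[in RHS]det_tr /determinant mulr_sumr.
apply: eq_bigr => s _; rewrite mulrCA; congr (_ * _).
by rewrite -big_split; apply: eq_bigr => i _; rewrite !mxE.
Qed.

(** As [c] is strictly increasing, only the first column can have index 0, so at most one term of
    the expansion along the first row survives. *)
Lemma det_first_row_delta (A : comPzRingType) m (M : nat -> nat -> A)
    (r c : 'I_m.+1 -> nat) :
  (forall k, M (r ord0) k = (k == 0%N)%:R) -> {homo c : i j / (i < j)%N} ->
  \det (\matrix_(i, j) M (r i) (c j)) =
  (c ord0 == 0%N)%:R *
    \det (\matrix_(i, j) M (r (lift ord0 i)) (c (lift ord0 j))).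
Proof.
move=> M0 c_homo; rewrite (expand_det_row _ ord0) big_ord_recl big1 => [|j _].
  rewrite mxE M0 addr0 /cofactor expr0 mul1r; congr (_ * \det _).
  by apply/matrixP => i j; rewrite !mxE.
have: (0 < c (lift ord0 j))%N by apply: leq_ltn_trans (c_homo ord0 _ _).
by rewrite mxE M0 lt0n => /negbTE ->; rewrite mul0r.
Qed.

(** A weakly increasing [c] is either injective, hence strict, or repeats a column, and then the
    determinant is zero. *)
Lemma minor_weakly_increasing_cols (A : comPzRingType) (S : semiringClosed A)
    (M : nat -> nat -> A) m (r c : 'I_m -> nat) :
  {homo c : i j / (i < j)%N >-> (i <= j)%N} ->
  ({homo c : i j / (i < j)%N} -> \det (\matrix_(i, j) M (r i) (c j)) \in S) ->
  \det (\matrix_(i, j) M (r i) (c j)) \in S.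
Proof.
move=> c_le minorS.
have [/injectiveP c_inj | /injectivePn [i [j ij cij]]] := boolP (injectiveb c).
  apply: minorS => i j ij; rewrite ltn_neqAle c_le // andbT.
  by apply: contraTneq ij => /c_inj ->; rewrite ltnn.
rewrite -det_tr (determinant_alternate ij) ?rpred0 // => k.
by rewrite !mxE cij.
Qed.

Lemma bidiagonal_recurrence_minor (A : comPzRingType) (S : semiringClosed A)
    (B : nat -> nat -> nat -> A) (a b : nat -> nat -> A) :
  (forall s k, a s k \in S) -> (forall s k, b s k \in S) ->
  (forall s k, B s 0%N k = (k == 0%N)%:R) ->
  (forall s n k,
     B s n.+1 k = a s k * B s.+1 n k + b s k * B s.+1 n k.-1) ->
  forall s m (r c : 'I_m -> nat),
    {homo r : i j / (i < j)%N} -> {homo c : i j / (i < j)%N} ->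
    \det (\matrix_(i, j) B s (r i) (c j)) \in S.
Proof.
move=> aS bS B0 BS s m r c r_homo c_homo.
(* The bound on [m + r i] drops in both cases below: discarding row 0 lowers [m], applying the
   recurrence lowers every [r i]. *)
have [N] : {N | forall i, (m + r i < N)%N}.
  exists (m + \max_i r i).+1 => i; rewrite ltnS leq_add2l.
  exact: leq_bigmax.
elim: N s m r c r_homo c_homo => [|N IHN] s [|m] r c r_homo c_homo ltN.
- by rewrite det_mx00 rpred1.
- by have := ltN ord0; rewrite ltn0.
- by rewrite det_mx00 rpred1.
have [r0|r_gt0] := posnP (r ord0).
  rewrite (@det_first_row_delta _ _ (B s)) => [|k|//]; last by rewrite r0 B0.
  rewrite rpredM ?rpred_nat //; apply: IHN => [i j ij|i j ij|i].
  - exact: r_homo.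
  - exact: c_homo.
  - by have := ltN (lift ord0 i); rewrite addSn ltnS.
have r_pos i : (0 < r i)%N.
  case: (unliftP ord0 i) => [j ->|->] //.
  exact: leq_ltn_trans (r_homo ord0 _ _).
pose x j (t : bool) := if t then b s (c j) else a s (c j).
pose d j (t : bool) := if t then (c j).-1 else c j.
have -> : \matrix_(i, j) B s (r i) (c j) =
    \matrix_(i, j) \sum_(t : bool) x j t * B s.+1 (r i).-1 (d j t).
  apply/matrixP => i j; rewrite !mxE big_bool -[r i in LHS]prednK // BS.
  by rewrite addrC.
rewrite det_col_bigsum rpred_sum // => f _.
rewrite (det_scale_cols (fun j => x j (f j))
  (fun i j => B s.+1 (r i).-1 (d j (f j)))) rpredM //.
  by apply: rpred_prod => j _; rewrite /x; case: ifP.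
apply: (@minor_weakly_increasing_cols _ _ (B s.+1) _
  (fun i => (r i).-1) (fun j => d j (f j))) => [i j ij|d_homo].
  (* Since [c i < c j], lowering [c j] alone gives at worst equality. *)
  have := c_homo _ _ ij; rewrite /d.
  by case: (f i); case: (f j); lia.
apply: IHN => // [i j ij|i].
  by have := r_homo _ _ ij; have := r_pos i; lia.
by have := ltN i; have := r_pos i; lia.
Qed.

Section Weights.
Variable A : comNzRingType.
Implicit Types (z : A) (n k s : nat).

Definition js_weight z n : A := n%:R * (n%:R + z).

(** Starting the weights at [s] lets the first factor be split off. *)
Definition js_genpoly z s n : {poly A} :=
  \prod_(i < n) ('X + (js_weight z (s + i))%:P).

Definition js_rev_genpoly z s n : {poly A} :=
  \prod_(i < n) (1 + js_weight z (s + i) *: 'X).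

Lemma js_weight0 z : js_weight z 0 = 0.
Proof. by rewrite /js_weight mul0r. Qed.

Lemma js_genpolyS z s n :
  js_genpoly z s n.+1 = ('X + (js_weight z s)%:P) * js_genpoly z s.+1 n.
Proof.
rewrite /js_genpoly big_ord_recl addn0; congr (_ * _).
by apply: eq_bigr => i _; rewrite addSnnS.
Qed.

Lemma js_rev_genpolyS z s n :
  js_rev_genpoly z s n.+1 =
  (1 + js_weight z s *: 'X) * js_rev_genpoly z s.+1 n.
Proof.
rewrite /js_rev_genpoly big_ord_recl addn0; congr (_ * _).
by apply: eq_bigr => i _; rewrite addSnnS.
Qed.

(** This is the term that the recurrence would give in column 0: the weight vanishes for [n = 0],
    and [js n 0 z] otherwise. *)
Lemma js_weight_js0 n z : js_weight z n * js n 0 z = 0.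
Proof. by case: n => [|n]; rewrite ?js_weight0 ?mul0r //= mulr0. Qed.

Lemma js_eq0 n k z : (n < k)%N -> js n k z = 0.
Proof.
elim: n k => [|n IHn] [|k] //= lt_nk.
by rewrite !IHn ?mulr0 ?addr0 // ltnW.
Qed.

Lemma coef_js_genpoly n k z : (js_genpoly z 0 n)`_k = js n k z.
Proof.
elim: n k => [|n IHn] k; first by rewrite /js_genpoly big_ord0 coef1; case: k.
rewrite /js_genpoly big_ord_recr /= -/(js_genpoly z 0 n) add0n mulrDr coefD.
rewrite coefMX coefMC !IHn mulrC; case: k => [|k] //=.
by rewrite add0r js_weight_js0.
Qed.

Lemma js_revS n k z :
  js_rev n.+1 k.+1 z = js_rev n k.+1 z + js_weight z n * js_rev n k z.
Proof.
rewrite /js_rev ltnS subSS; have [lt_kn|gt_kn|->] := ltngtP k n.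
- by rewrite -[(n - k)%N]prednK ?subn_gt0 // -subnS.
- by rewrite mulr0 addr0.
- by rewrite subnn js_weight_js0 addr0.
Qed.

Lemma js_diag n z : js n n z = 1.
Proof. by elim: n => //= n ->; rewrite js_eq0 ?mulr0 ?addr0. Qed.

Lemma coef_js_rev_genpoly n k z : (js_rev_genpoly z 0 n)`_k = js_rev n k z.
Proof.
elim: n k => [|n IHn] k.
  by rewrite /js_rev_genpoly big_ord0 coef1; case: k.
rewrite /js_rev_genpoly big_ord_recr /= -/(js_rev_genpoly z 0 n) add0n mulrDr.
rewrite mulr1 -scalerAr coefD coefZ coefMX !IHn; case: k => [|k] /=.
  by rewrite mulr0 addr0 /js_rev !subn0 !js_diag.
by rewrite js_revS.
Qed.

End Weights.

(** A named predicate to carry the semiring instance that the [rpred] lemmas use. *)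
Definition nneg_poly (R : realFieldType) : {pred {poly R}} :=
  [pred p | p \is a polyOver Num.nneg].
Arguments nneg_poly : clear implicits.

Lemma nneg_polyP (R : realFieldType) (p : {poly R}) :
  reflect (forall i, 0 <= p`_i) (p \in nneg_poly R).
Proof.
rewrite inE; apply: (iffP (all_nthP 0)) => [p_ge0 i|p_ge0 i _] /=.
  have [/p_ge0 //|le_pi] := ltnP i (size p).
  by rewrite nth_default.
exact: p_ge0.
Qed.

Lemma nneg_poly_semiring_closed (R : realFieldType) :
  semiring_closed (nneg_poly R).
Proof.
split; split=> [|p q /nneg_polyP p_ge0 /nneg_polyP q_ge0];
  apply/nneg_polyP => i.
- by rewrite coef0.
- by rewrite coefD addr_ge0.
- by rewrite coef1 ler0n.
- by rewrite coefM sumr_ge0 // => j _; rewrite mulr_ge0.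
Qed.

HB.instance Definition _ (R : realFieldType) :=
  GRing.isSemiringClosed.Build {poly R} (nneg_poly R)
    (nneg_poly_semiring_closed R).

(** The shift by -1 turns the second factor at [n.+1] into [n%:R + 'X]; at 0, where it is ['X - 1],
    the first factor is zero. *)
Lemma js_weight_nneg (R : realFieldType) n :
  js_weight ('X - 1 : {poly R}) n \in nneg_poly R.
Proof.
case: n => [|n]; first by rewrite js_weight0 rpred0.
have -> : js_weight ('X - 1 : {poly R}) n.+1 = n.+1%:R * (n%:R + 'X).
  by rewrite /js_weight; ring.
rewrite rpredM ?rpredD ?rpred_nat //.
by apply/nneg_polyP => i; rewrite coefX ler0n.
Qed.

Theorem theorem1p3 (R : realFieldType) :
  [/\ z_totally_positive (fun n k : nat => JS n k ('X - 1 : {poly R})),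
      z_totally_positive (fun n k : nat => js_rev n k ('X - 1 : {poly R})) &
      z_totally_positive (fun n k : nat => js n k ('X - 1 : {poly R}))].
Proof.
have w_nneg := js_weight_nneg R.
set z := ('X - 1 : {poly R}) in w_nneg *.
split=> m r c r_homo c_homo; rewrite /minor;
  rewrite -[is_true _]/(is_true (_ \in nneg_poly R)).
(* The coefficient of the shifted column is 0 at [k = 0], where [k.-1] would return column 0
   again. *)
- apply: (@bidiagonal_recurrence_minor _ _ (fun _ n k => JS n k z)
    (fun=> js_weight z) (fun _ k => (0 < k)%N%:R) _ _ _ _ 0%N) => //.
  + by move=> _ k; rewrite rpred_nat.
  + by move=> _ [].
  + move=> _ n [|k]; first by rewrite js_weight0 !mul0r addr0.
    by rewrite mul1r addrC.
- under eq_mx => i j do rewrite -coef_js_rev_genpoly.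
  apply: (@bidiagonal_recurrence_minor _ _
    (fun s n k => (js_rev_genpoly z s n)`_k)
    (fun=> fun=> 1) (fun s k => (0 < k)%N%:R * js_weight z s)
    _ _ _ _ 0%N) => //.
  + by move=> s k; rewrite rpred1.
  + by move=> s k; rewrite rpredM ?rpred_nat.
  + by move=> s k; rewrite /js_rev_genpoly big_ord0 coef1.
  + move=> s n k; rewrite js_rev_genpolyS mulrDl -scalerAl coefD coefZ coefXM.
    by case: k => [|k]; rewrite !mul1r ?mul0r ?mulr0.
- under eq_mx => i j do rewrite -coef_js_genpoly.
  apply: (@bidiagonal_recurrence_minor _ _
    (fun s n k => (js_genpoly z s n)`_k)
    (fun s _ => js_weight z s) (fun _ k => (0 < k)%N%:R)
    _ _ _ _ 0%N) => //.
  + by move=> s k; rewrite rpred_nat.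
  + by move=> s k; rewrite /js_genpoly big_ord0 coef1.
  + move=> s n k; rewrite js_genpolyS mulrDl coefD coefCM coefXM addrC.
    by case: k => [|k]; rewrite ?mul1r ?mul0r.
Qed.
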